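(* Let $\psi(t)=e^{t^2}-1$. For every $n\ge 1$ and every discrete martingale-difference sequence $d=\{d_1,\dots,d_n\}$, $$\left\|\sum_{k=1}^n d_k\right\|_\psi\le\sqrt{\frac83}\cdot\|\mathfrak S(d)\|_\infty,$$ and this bound is sharp (the constant $\sqrt{8/3}$ cannot be replaced by a smaller one valid for all $n$ and all such $d$).
   Context: All random variables are real-valued. For the Young function $\psi(t)=e^{t^2}-1$, the Luxemburg norm of a random variable $f$ is $\|f\|_\psi=\inf\{u>0:\ \mathbf E[\psi(f/u)]\le 1\}$. Let $(X,\mathscr F,\mu)$ be a probability space. A discrete filtration is an increasing sequence of $\sigma$-algebras $\mathscr F_0\subset\mathscr F_1\subset\dots\subset\mathscr F$ such that each $\mathscr F_k$ is generated by a finite or countable partition $\mathscr D_k$ of $X$ into disjoint measurable sets of positive measure, where $\mathscr D_0=\{X\}$ and every set in $\mathscr D_k$ is a union of elements of $\mathscr D_{k+1}$. A discrete martingale-difference sequence $d=\{d_1,\dots,d_n\}$ with respect to such a filtration is a sequence of integrable random variables with $d_k$ being $\mathscr F_k$-measurable and $\int_V d_k\,d\mu=0$ for every $V\in\mathscr D_{k-1}$, $k=1,\dots,n$. Its square function is $$\mathfrak S(d)(x)=\Big(\sum_{k=1}^n |D_k(x)|^2\Big)^{1/2},\qquad D_k(x)=\sum_{V\in\mathscr D_{k-1}}\|\mathbf 1_V d_k\|_\infty\,\mathbf 1_V(x).$$ The probability space and the filtration are arbitrary. *)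

(* Defs.v *)
From HB Require Import structures.
From mathcomp Require Import all_boot all_order all_algebra.
From mathcomp Require Import all_classical all_reals all_analysis.

Set Implicit Arguments.
Unset Strict Implicit.
Unset Printing Implicit Defensive.

Import Order.TTheory GRing.Theory Num.Theory.
Import numFieldNormedType.Exports.

Local Open Scope classical_set_scope.
Local Open Scope ring_scope.
Local Open Scope ereal_scope.

(* Takes the value +oo when no u > 0 is admissible (infimum of the empty set). *)
Definition luxemburg_norm (disp : measure_display) (T : measurableType disp)
    (R : realType) (P : probability T R) (psi : R -> R) (f : T -> R) : \bar R :=
  ereal_inf [set u%:E | u in
    [set u : R | (0 < u)%R /\ 'E_P[fun x => psi (f x / u)%R] <= 1]].

Definition psi_exp2 (R : realType) (t : R) : R := (expR (t ^+ 2) - 1)%R.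

(* The filtration is recorded by its partitions D k; its k-th sigma-algebra is
   <<s D k>>. Only D 0, ..., D n matter for a sequence d_1, ..., d_n, and a
   finite filtration extends to all of nat by repeating its last partition. *)
Definition discrete_filtration (disp : measure_display)
    (T : measurableType disp) (R : realType) (P : probability T R)
    (D : nat -> set (set T)) : Prop :=
  [/\ D 0%N = [set [set: T]],
      forall k, countable (D k) /\ partition (D k) id [set: T],
      forall k V, D k V -> measurable V /\ 0 < P V
    & forall k V, D k V ->
        exists2 E : set (set T), E `<=` D k.+1 & V = \bigcup_(W in E) W].

(* Only the values d 1, ..., d n are used. *)
Definition martingale_difference (disp : measure_display)
    (T : measurableType disp) (R : realType) (P : probability T R)
    (D : nat -> set (set T)) (n : nat) (d : nat -> T -> R) : Prop :=
  forall k, (1 <= k <= n)%N ->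
    [/\ P.-integrable [set: T] (EFin \o d k),
        measurable_fun [set: g_sigma_algebraType (D k)]
          (d k : g_sigma_algebraType (D k) -> R)
      & forall V, D k.-1 V -> \int[P]_(x in V) (d k x)%:E = 0].

(* Extended-real valued: d k may be unbounded on an element of D k.-1. *)
Definition predictable_majorant (disp : measure_display)
    (T : measurableType disp) (R : realType) (P : probability T R)
    (D : nat -> set (set T)) (d : nat -> T -> R) (k : nat) (x : T) : \bar R :=
  \esum_(V in D k.-1)
    (Lnorm P +oo (fun y => (\1_V y * d k y)%:E) * (\1_V x)%:E).

Definition square_function (disp : measure_display)
    (T : measurableType disp) (R : realType) (P : probability T R)
    (D : nat -> set (set T)) (n : nat) (d : nat -> T -> R) (x : T) : \bar R :=
  sqrte (\sum_(1 <= k < n.+1) `|predictable_majorant P D d k x| ^+ 2).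

(* Main.v *)
Require Import Defs.
From HB Require Import structures.
From mathcomp Require Import all_boot all_order all_algebra.
From mathcomp Require Import all_classical all_reals all_analysis.
From mathcomp Require Import measurable_realfun ess_sup_inf.
From mathcomp Require Import ring lra.

(** Upper bound.  Let s >= ||S(d)||_oo and a = 3 / (8 s^2).  The heat evolution
    W(x, c) = exp(a x^2 / c) / sqrt c satisfies
    (W(x + D, c) + W(x - D, c)) / 2 <= W(x, c - 2 a D^2), because
    cosh t <= exp(t^2 / 2).  By convexity of W in x, the integral of
    W(f_k, 1/4 + 2 a (D_1^2 + ... + D_k^2)), with f_k the k-th partial sum, is
    nonincreasing in k.  It equals W(0, 1/4) = 2 for k = 0, and it dominates
    the integral of exp(a f_n^2) for k = n since 2 a s^2 = 3/4.

    Sharpness.  For the Rademacher sums S_n, keeping two terms of the binomial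
    expansion of (S_n +- 1)^(2j) gives E S_n^(2j) >= (2j-1)!! n(n-1)...(n-j+1),
    so that liminf E exp(t S_n^2 / (2n)) >= \sum_j C(2j, j) (t / 4)^j.  The
    square of this series is \sum_k t^k = 1 / (1 - t), which exceeds 4 as soon
    as t > 3/4. *)

Set Implicit Arguments.
Unset Strict Implicit.
Unset Printing Implicit Defensive.

Import Order.TTheory GRing.Theory Num.Theory.
Import numFieldNormedType.Exports.

Local Open Scope classical_set_scope.
Local Open Scope ring_scope.

(** * The heat evolution of a Gaussian function *)

Section real.
Variable R : realType.
Implicit Types (a b c x y g D t : R) (n j k : nat).

Lemma series_exp_coeff_le x n : 0 <= x -> series (exp_coeff x) n <= expR x.
Proof.
move=> x0; rewrite /expR; apply: nondecreasing_cvgn_le.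
  apply/nondecreasing_seqP => m; rewrite seriesSr lerDl.
  exact: exp_coeff_ge0.
exact: is_cvg_series_exp_coeff.
Qed.

Lemma expn2_fact_le k : (2 ^ k * k`! <= (k.*2)`!)%N.
Proof.
elim: k => // k IH; rewrite doubleS !factS expnS.
have -> : (2 * 2 ^ k * (k.+1 * k`!) = (k.+1).*2 * (2 ^ k * k`!))%N.
  by rewrite -muln2; ring.
by rewrite doubleS; apply: leq_mul => //; apply: leq_trans IH (leq_pmull _ _).
Qed.

(** The odd powers cancel, and [expn2_fact_le] compares the even ones term by term with the series
    of exp(t^2 / 2). Stopping at [n.*2] keeps even and odd powers paired. *)
Lemma series_cosh_le t n :
  series (exp_coeff t) n.*2 + series (exp_coeff (- t)) n.*2
  <= 2 * series (exp_coeff (t ^+ 2 / 2)) n.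
Proof.
elim: n => [|n IH]; first by rewrite /series/= !big_geq// mulr0 addr0.
rewrite doubleS !seriesSr mulrDr.
suff : exp_coeff t n.*2 + exp_coeff t n.*2.+1 +
    (exp_coeff (- t) n.*2 + exp_coeff (- t) n.*2.+1) <=
    2 * exp_coeff (t ^+ 2 / 2) n by lra.
have even_pow : (- t) ^+ n.*2 = t ^+ n.*2 by rewrite -mul2n !exprM sqrrN.
rewrite /exp_coeff/= [(- t) ^+ _.+1]exprS even_pow mulNr -exprS mulNr.
have -> : forall u v : R, u + v + (u - v) = 2 * u by move=> u v; ring.
rewrite ler_pM2l// -{1}mul2n exprM expr_div_n -mulrA ler_wpM2l//.
  by rewrite exprn_ge0// sqr_ge0.
rewrite -invfM lef_pV2 ?posrE ?mulr_gt0 ?exprn_gt0 ?ltr0n ?fact_gt0//.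
by rewrite -natrX -natrM ler_nat expn2_fact_le.
Qed.

Lemma cosh_le_expR t : expR t + expR (- t) <= 2 * expR (t ^+ 2 / 2).
Proof.
pose dbl n := n.*2.
have dbl_cvg : dbl n @[n --> \oo] --> \oo.
  by apply/cvgnyPge => A; exists A => // m /= Am; 
    rewrite (leq_trans Am)// /dbl -addnn leq_addr.
have h (z : R) : (series (exp_coeff z) \o dbl) n @[n --> \oo] --> expR z.
  exact: (cvg_comp _ _ dbl_cvg (is_cvg_series_exp_coeff z)).
have hl : series (exp_coeff t) n.*2 + series (exp_coeff (- t)) n.*2
    @[n --> \oo] --> expR t + expR (- t) by apply: cvgD; exact: h.
have hr : 2 * series (exp_coeff (t ^+ 2 / 2)) n @[n --> \oo] -->
    2 * expR (t ^+ 2 / 2).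
  by apply: cvgMr; exact: is_cvg_series_exp_coeff.
rewrite -(cvg_lim _ hl)// -(cvg_lim _ hr)//.
apply: ler_lim; [exact: cvgP hl|exact: cvgP hr|].
by apply: nearW => n /=; exact: series_cosh_le.
Qed.

(** By convexity exp(b z^2) lies below its chord over [x - D, x + D]. The chord is written as an
    affine function of [g], so that its linear part integrates to zero when [g] is a martingale
    difference. *)
Lemma expR_sq_chord b D x g : 0 <= b -> `|g| <= D ->
  expR (b * (x + g) ^+ 2) <=
  (expR (b * (x + D) ^+ 2) + expR (b * (x - D) ^+ 2)) / 2 +
  (expR (b * (x + D) ^+ 2) - expR (b * (x - D) ^+ 2)) / (2 * D) * g.
Proof.
move=> b0 gD; have [D0|D0] := eqVneq D 0.
  have -> : g = 0 by apply/eqP; rewrite -normr_le0 -D0.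
  by rewrite D0 mulr0 subr0 addr0; lra.
have Dp : 0 < D by rewrite lt_neqAle eq_sym D0 (le_trans _ gD).
move: gD; rewrite ler_norml => /andP[g1 g2].
set u1 := b * (x + D) ^+ 2; set u2 := b * (x - D) ^+ 2.
set v := b * (x + g) ^+ 2.
(* The weight for which x + g = t (x + D) + (1 - t) (x - D). *)
pose t := (D + g) / (2 * D).
have t0 : 0 <= t by rewrite /t divr_ge0//; lra.
have t1 : t <= 1 by rewrite /t ler_pdivrMr; lra.
(* Convexity of [expR] enters through its tangent at [v], averaged below with weights t and 1 -
   t. *)
have tang u : expR v * (1 + (u - v)) <= expR u.
  have -> : expR u = expR v * expR (u - v) by rewrite -expRD; congr expR; lra.
  by rewrite ler_wpM2l ?expR_ge0// expR_ge1Dx.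
have convex : v <= t * u1 + (1 - t) * u2.
  have -> : t * u1 + (1 - t) * u2 = v + b * (D ^+ 2 - g ^+ 2).
    by rewrite /t /u1 /u2 /v; field.
  by rewrite lerDl mulr_ge0// subr_sqr mulr_ge0//; lra.
have -> : (expR u1 + expR u2) / 2 + (expR u1 - expR u2) / (2 * D) * g =
    t * expR u1 + (1 - t) * expR u2 by rewrite /t; field.
have h1 := tang u1; have h2 := tang u2; have ev := expR_ge0 v.
apply: (@le_trans _ _
  (t * (expR v * (1 + (u1 - v))) + (1 - t) * (expR v * (1 + (u2 - v))))).
  have -> : t * (expR v * (1 + (u1 - v))) + (1 - t) * (expR v * (1 + (u2 - v))) =
    expR v * (1 + (t * u1 + (1 - t) * u2 - v)) by ring.
  by rewrite ler_peMr//; lra.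
by rewrite lerD// ler_wpM2l//; lra.
Qed.

(** For a > 0 and 0 < c <= 1 this is the expectation of exp(a (x + sqrt v Z)^2), with Z standard
    Gaussian and c = 1 - 2 a v. *)
Definition gauss_evol a x c : R := expR (a / c * x ^+ 2) / Num.sqrt c.

(** A random sign of size D is dominated by a Gaussian of variance D^2. With b = a / c and y = 2 b
    D^2, the bound on cosh yields the factor exp(y / 2) and the exponent b x^2 (1 + y); then 1 + y
    <= 1 / (1 - y) and exp(y / 2) <= 1 / sqrt(1 - y). *)
Lemma gauss_evol_step a c D x : 0 < a -> 2 * a * D ^+ 2 < c ->
  (gauss_evol a (x + D) c + gauss_evol a (x - D) c) / 2 <=
  gauss_evol a x (c - 2 * a * D ^+ 2).
Proof.
move=> a0 hc; have D0 := sqr_ge0 D.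
have c0 : 0 < c by apply: le_lt_trans hc; rewrite pmulr_rge0// mulr_gt0.
rewrite /gauss_evol -mulrDl; set b := a / c.
have b0 : 0 < b by rewrite divr_gt0.
pose y := 2 * b * D ^+ 2.
have y0 : 0 <= y by rewrite /y pmulr_rge0// mulr_gt0.
have yE : y = 2 * a * D ^+ 2 / c by rewrite /y /b; ring.
have y1 : y < 1 by rewrite yE ltr_pdivrMr// mul1r.
have -> : c - 2 * a * D ^+ 2 = c * (1 - y) by rewrite yE; field; lra.
have cosh : (expR (b * (x + D) ^+ 2) + expR (b * (x - D) ^+ 2)) / 2 <=
    expR (y / 2) * expR (b * x ^+ 2 * (1 + y)).
  have e1 : b * (x + D) ^+ 2 = b * x ^+ 2 + y / 2 + 2 * b * x * D.
    by rewrite /y; field.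
  have e2 : b * (x - D) ^+ 2 = b * x ^+ 2 + y / 2 + - (2 * b * x * D).
    by rewrite /y; field.
  have e3 : expR (y / 2) * expR (b * x ^+ 2 * (1 + y)) =
     expR (b * x ^+ 2 + y / 2) * expR ((2 * b * x * D) ^+ 2 / 2).
    by rewrite -!expRD; congr expR; rewrite /y; field.
  rewrite e1 e2 e3 ![expR (_ + _ + _)]expRD -mulrDr -mulrA ler_wpM2l ?expR_ge0//.
  by have := cosh_le_expR (2 * b * x * D); lra.
have lin : expR (b * x ^+ 2 * (1 + y)) <= expR (a / (c * (1 - y)) * x ^+ 2).
  rewrite ler_expR -mulrA [_ * (1 + y)]mulrC mulrA ler_wpM2r ?sqr_ge0//.
  rewrite invfM mulrA -/b ler_pM2l//.
  by rewrite -[leRHS]div1r ler_pdivlMr; nra.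
have rt : expR (y / 2) <= (Num.sqrt (1 - y))^-1.
  rewrite -[expR _]invrK -expRN lef_pV2 ?posrE ?expR_gt0 ?sqrtr_gt0 ?subr_gt0//.
  rewrite -(ler_sqr) ?nnegrE ?sqrtr_ge0 ?expR_ge0// sqr_sqrtr; last lra.
  rewrite -expRM_natr; have -> : - (y / 2) * 2 = - y by field.
  by have := expR_ge1Dx (- y).
rewrite sqrtrM ?(ltW c0)// [(Num.sqrt c * _)^-1]invfM.
rewrite [(Num.sqrt c)^-1 * _]mulrC [leRHS]mulrA [leLHS]mulrAC.
rewrite ler_wpM2r ?invr_ge0 ?sqrtr_ge0//.
apply: le_trans cosh _; rewrite mulrC; apply: ler_pM => //; exact: expR_ge0.
Qed.

Lemma gauss_evol_ge0 a x c : 0 <= gauss_evol a x c.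
Proof. by rewrite divr_ge0 ?expR_ge0 ?sqrtr_ge0. Qed.

Lemma gauss_evol_anti a x c : 0 <= a -> 0 < c -> c <= 1 ->
  expR (a * x ^+ 2) <= gauss_evol a x c.
Proof.
move=> a0 c0 c1; rewrite /gauss_evol.
apply: (@le_trans _ _ (expR (a / c * x ^+ 2))).
  rewrite ler_expR ler_wpM2r ?sqr_ge0// ler_peMr// invf_ge1//.
rewrite ler_peMr ?expR_ge0// invf_ge1 ?sqrtr_gt0//.
by rewrite -sqrtr1 ler_sqrt.
Qed.

End real.

(** * Discrete filtrations and the upper bound *)

Section partitions.
Variable T : Type.
Implicit Type D : set (set T).

(** Pointwise substitute for measurability with respect to [<<s D>>]; [g_sigma_measurable_atomwise]
    and [atomwise_measurable] pass between the two. *)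
Definition atomwise U D (f : T -> U) :=
  forall V x y, D V -> V x -> V y -> f x = f y.

(** An injection into nat gives each block its index, and the remaining indices receive the empty
    set, so that countable additivity applies to a sequence. *)
Lemma partition_enum D : countable D -> partition D id [set: T] ->
  exists F : nat -> set T, [/\ trivIset [set: nat] F, \bigcup_k F k = [set: T]
    & forall k, F k = set0 \/ D (F k)].
Proof.
move=> /countable_injP[f finj] [cov triv _].
exists (fun k => \bigcup_(V in [set V | D V /\ f V = k]) V); split.
- move=> i j _ _ [x [[V [DV <-] Vx] [W [DW <-] Wx]]].
  by rewrite (triv V W DV DW)//; exists x.
- apply/seteqP; split=> // x _.
  have [V DV Vx] : cover D id x by rewrite cov.
  by exists (f V) => //; exists V.
- move=> k; have [[V [DV fV]]|noV] := pselect (exists V, D V /\ f V = k).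
    right; rewrite (_ : \bigcup_(_ in _) _ = V)//.
    apply/seteqP; split=> [x [W [DW fW] Wx]|x Vx]; last by exists V.
    by rewrite (finj V W) ?inE// fW.
  left; rewrite -subset0 => x [V [DV fV] _]; apply: noV; by exists V.
Qed.

Lemma partition_mem D x : partition D id [set: T] -> exists2 V, D V & V x.
Proof.
move=> [cov _ _]; have [V DV Vx] : cover D id x by rewrite cov.
by exists V.
Qed.

(** The sets that contain every atom they meet form a sigma-algebra containing [D]. *)
Lemma g_sigma_saturated D (A : set T) : partition D id [set: T] -> <<s D >> A ->
  forall V x y, D V -> V x -> V y -> A x -> A y.
Proof.
move=> [_ triv _]; pose sat := [set A : set T |
  forall V x y, D V -> V x -> V y -> A x -> A y].
suff : <<s D >> `<=` sat by move=> sub DA; exact: sub DA.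
apply: smallest_sub; last first.
  by move=> B DB V x y DV Vx Vy Bx; rewrite -(triv V B)//; exists x.
split.
- by move=> V x y _ _ _ [].
- move=> B satB V x y DV Vx Vy [_ nBx]; split=> // By.
  by apply: nBx; exact: (satB V y x).
- by move=> F satF V x y DV Vx Vy [k _ Fx]; exists k => //; exact: (satF k V x).
Qed.

End partitions.

Lemma atomwise_measurable disp (T : measurableType disp) disp'
    (U : measurableType disp') (D : set (set T)) (f : T -> U) :
  countable D -> partition D id [set: T] -> (forall V, D V -> measurable V) ->
  atomwise D f -> measurable_fun [set: T] f.
Proof.
move=> cD pD mD af _ B mB; rewrite setTI.
have [F [_ FT FD]] := partition_enum cD pD.
rewrite (_ : f @^-1` B = \bigcup_(k in [set k | F k `<=` f @^-1` B]) F k).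
  apply: bigcup_measurable => k _; have [->//|] := FD k; exact: mD.
apply/seteqP; split=> [x Bx|x [k + Fkx]]; last exact.
have [k _ Fkx] : (\bigcup_k F k) x by rewrite FT.
exists k => // y Fky; have [F0|DF] := FD k; first by rewrite F0 in Fky.
by rewrite /= (af _ y x DF).
Qed.

Lemma g_sigma_measurable_atomwise disp (T : measurableType disp)
    (R : realType) (D : set (set T)) (f : T -> R) :
  partition D id [set: T] ->
  measurable_fun [set: g_sigma_algebraType D] (f : g_sigma_algebraType D -> R) ->
  atomwise D f.
Proof.
move=> pD mf V x y DV Vx Vy.
have := mf measurableT [set f x] (measurable_set1 _); rewrite setTI => sA.
by have /= := g_sigma_saturated pD sA DV Vx Vy erefl.
Qed.

Lemma atomwise_comp T U U' (D : set (set T)) (g : U -> U') (f : T -> U) :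
  atomwise D f -> atomwise D (g \o f).
Proof. by move=> af V x y DV Vx Vy /=; rewrite (af V x y). Qed.

(** * Integration over a countable partition *)

Section partition_measure.
Local Open Scope ereal_scope.
Context disp (T : measurableType disp) (R : realType).
Variable mu : {measure set T -> \bar R}.
Variable D : set (set T).
Hypotheses (cD : countable D) (pD : partition D id [set: T]).
Hypothesis mD : forall V, D V -> measurable V.

(** Takes the place of conditional expectation: a supermartingale inequality is checked atom by
    atom. *)
Lemma ge0_le_integral_partition (f g : T -> \bar R) :
  measurable_fun [set: T] f -> measurable_fun [set: T] g ->
  (forall x, 0 <= f x) -> (forall x, 0 <= g x) ->
  (forall V, D V -> \int[mu]_(x in V) f x <= \int[mu]_(x in V) g x) ->
  \int[mu]_x f x <= \int[mu]_x g x.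
Proof.
move=> mf mg f0 g0 fg; have [F [trivF FT FD]] := partition_enum cD pD.
have mF k : measurable (F k) by have [->//|] := FD k; exact: mD.
rewrite -FT !ge0_integral_bigcup// ?FT//.
apply: lee_nneseries => k _; first by rewrite integral_ge0.
have [->|DF] := FD k; first by rewrite !integral_set0.
exact: fg.
Qed.

(** If [Q] fails at a point it fails on the whole atom, and no atom fits in a null set. *)
Lemma ae_atomwise (Q : T -> Prop) : (forall V, D V -> 0 < mu V) ->
  (forall V x y, D V -> V x -> V y -> Q x -> Q y) ->
  (\forall x \ae mu, Q x) -> forall x, Q x.
Proof.
move=> pos satQ [N [mN N0 QN]] x; have [V DV Vx] := partition_mem x pD.
apply: contrapT => nQx; have : V `<=` N.
  by move=> y Vy; apply: QN => /= Qy; exact/nQx/(satQ V y x).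
move=> VN; have := pos V DV; rewrite ltNge -N0 => /negP; apply.
by apply: le_measure => //; rewrite inE//; exact: mD.
Qed.

End partition_measure.

Lemma Lnorm_probability_oo disp (T : measurableType disp) (R : realType)
    (P : probability T R) (f : T -> \bar R) :
  (Lnorm P +oo f = ess_sup P (abse \o f))%E.
Proof.
rewrite Lnorm.unlock ifT//.
by have := probability_setT P => /= ->; rewrite lte01.
Qed.

Lemma integral_cst_probability disp (T : measurableType disp) (R : realType)
    (P : probability T R) (r : \bar R) : (\int[P]_x cst r x = r)%E.
Proof.
rewrite integral_cst// [X in (_ * X)%E](_ : _ = 1%E) ?mule1//.
exact: probability_setT.
Qed.

(** * Atoms along a filtration *)

Section upper.
Local Open Scope ereal_scope.
Context disp (T : measurableType disp) (R : realType) (P : probability T R).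
Variable D : nat -> set (set T).
Hypothesis filtD : discrete_filtration P D.

Lemma filt_countable k : countable (D k).
Proof. by case: filtD => _ /(_ k)[]. Qed.

Lemma filt_partition k : partition (D k) id [set: T].
Proof. by case: filtD => _ /(_ k)[]. Qed.

Lemma filt_measurable k V : D k V -> measurable V.
Proof. by case: filtD => _ _ + _ => /(_ k V) h /h[]. Qed.

Lemma filt_pos k V : D k V -> 0 < P V.
Proof. by case: filtD => _ _ + _ => /(_ k V) h /h[]. Qed.

(** Induction on [k]: the atom of level k through x lies in [V], and being a union of atoms of the
    next level it contains the one through x. *)
Lemma filt_refine j k V W x y : (j <= k)%N -> D j V -> V x ->
  D k W -> W x -> W y -> V y.
Proof.
elim: k V W => [|k IH] V W.
  rewrite leqn0 => /eqP -> DV Vx DW Wx Wy.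
  by have [_ triv _] := filt_partition 0; rewrite (triv V W)//; exists x.
rewrite leq_eqVlt => /orP[/eqP-> DV Vx DW Wx Wy|].
  by have [_ triv _] := filt_partition k.+1; rewrite (triv V W)//; exists x.
rewrite ltnS => jk DV Vx DW Wx Wy.
have [U DU Ux] := partition_mem x (filt_partition k).
apply: (IH V U jk DV Vx DU Ux).
case: filtD => _ _ _ /(_ k U DU)[E ED UE]; move: Ux; rewrite UE => -[W' EW' W'x].
exists W' => //; have [_ triv _] := filt_partition k.+1.
by rewrite (triv W' W)//; [exact: ED|exists x].
Qed.

Lemma atomwise_refine U j k (f : T -> U) : (j <= k)%N ->
  atomwise (D j) f -> atomwise (D k) f.
Proof.
move=> jk af W x y DW Wx Wy.
have [V DV Vx] := partition_mem x (filt_partition j).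
by apply: (af V) => //; exact: (filt_refine jk DV Vx DW Wx).
Qed.

Lemma filt_measurable_fun k disp' (U : measurableType disp') (f : T -> U) :
  atomwise (D k) f -> measurable_fun [set: T] f.
Proof.
apply: atomwise_measurable (@filt_countable k) (filt_partition k) _.
exact: filt_measurable.
Qed.

(** * Predictable majorants and the square function *)

Section majorant.
Variables (d : nat -> T -> R).
Let maj := predictable_majorant P D d.

(** Atoms are disjoint, so only the one through [x] contributes to the sum. *)
Lemma predictable_majorantE k V x : D k.-1 V -> V x ->
  maj k x = Lnorm P +oo (fun y => (\1_V y * d k y)%:E).
Proof.
move=> DV Vx; rewrite /maj /predictable_majorant.
have [_ triv _] := filt_partition k.-1.
have term_ge0 W : 0 <= Lnorm P +oo (fun y => (\1_W y * d k y)%:E) * (\1_W x)%:E.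
  by rewrite mule_ge0 ?Lnorm_ge0// lee_fin indicE.
rewrite (esumID [set V])// [X in _ + X]esum1 ?adde0; last first.
  move=> W [DW WV]; rewrite indicE memNset ?mule0// => Wx.
  by apply: WV => /=; apply: (triv W V) => //; exists x.
rewrite (_ : _ `&` _ = [set V]); last first.
  by apply/seteqP; split=> [W [_ ->]//|W ->].
by rewrite esum_set1// indicE mem_set// mule1.
Qed.

Lemma predictable_majorant_ge0 k x : 0 <= maj k x.
Proof.
by apply: esum_ge0 => W _; rewrite mule_ge0 ?Lnorm_ge0// lee_fin indicE.
Qed.

Lemma predictable_majorant_atomwise k : atomwise (D k.-1) (maj k).
Proof.
by move=> V x y DV Vx Vy; rewrite (predictable_majorantE DV Vx)
  (predictable_majorantE DV Vy).
Qed.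

(* Essential bounds are pointwise bounds here: d k is constant on the atoms of
   D k, and these have positive probability. *)
Lemma normr_le_majorant k x : atomwise (D k) (d k) -> `|d k x|%:E <= maj k x.
Proof.
move=> ad; have [V DV Vx] := partition_mem x (filt_partition k.-1).
rewrite (predictable_majorantE DV Vx); set L := Lnorm _ _ _.
have : forall y, `|(\1_V y * d k y)%:E| <= L.
  apply: (@ae_atomwise _ _ _ P (D k) (filt_partition k)).
  - exact: filt_measurable.
  - exact: filt_pos.
  - move=> W y z DW Wy Wz; rewrite (ad W y z)//.
    suff -> : \1_V y = \1_V z :> R by [].
    rewrite !indicE; congr (_%:R); congr nat_of_bool.
    by apply/idP/idP; rewrite !inE => h;
      [apply: (filt_refine (leq_pred k) DV h DW)|
       apply: (filt_refine (leq_pred k) DV h DW)].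
  - rewrite /L Lnorm_probability_oo; exact: ess_sup_ge.
by move=> /(_ x); rewrite indicE mem_set// mul1r.
Qed.

(** The square function is constant on the atoms of [D n], so its essential bound holds at every
    point. *)
Lemma sum_sqr_majorant_le n s x : (0 <= s)%R ->
  Lnorm P +oo (square_function P D n d) <= s%:E ->
  \sum_(1 <= k < n.+1) maj k x ^+ 2 <= (s ^+ 2)%:E.
Proof.
move=> s0 Ss; have maj_abs k y : `|maj k y| = maj k y.
  by rewrite gee0_abs// predictable_majorant_ge0.
have SE y : `|square_function P D n d y| =
    sqrte (\sum_(1 <= k < n.+1) maj k y ^+ 2).
  rewrite gee0_abs ?sqrte_ge0//; congr sqrte.
  by apply: eq_bigr => k _; rewrite maj_abs.
have pw y : `|square_function P D n d y| <= s%:E.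
  move: y; apply: (@ae_atomwise _ _ _ P (D n) (filt_partition n)).
  - exact: filt_measurable.
  - exact: filt_pos.
  - move=> W y z DW Wy Wz; rewrite !SE.
    rewrite (_ : \sum_(1 <= k < n.+1) maj k z ^+ 2 =
      \sum_(1 <= k < n.+1) maj k y ^+ 2)//.
    apply: eq_big_nat => k /andP[_ kn]; congr (_ ^+ 2).
    apply: (atomwise_refine _ (@predictable_majorant_atomwise k) DW Wz Wy).
    by rewrite (leq_trans (leq_pred k)).
  - move: Ss; rewrite Lnorm_probability_oo => Ss.
    by apply: filterS (ess_sup_ge _ _) => y /le_trans; exact.
have := pw x; rewrite SE => h.
rewrite -[leLHS]sqr_sqrte; last by apply: sume_ge0 => k _; rewrite sqre_ge0.
by rewrite EFin_expe lee_sqr// ?sqrte_ge0 ?lee_fin.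
Qed.

End majorant.

(** * The exponential supermartingale *)

Section supermartingale.
Variables (d delta : nat -> T -> R) (n : nat) (s : R).
Hypothesis s0 : (0 < s)%R.
Hypothesis d_atomwise : forall k, (1 <= k <= n)%N -> atomwise (D k) (d k).
Hypothesis d_integrable : forall k, (1 <= k <= n)%N ->
  P.-integrable [set: T] (EFin \o d k).
Hypothesis d_mean0 : forall k V, (1 <= k <= n)%N -> D k.-1 V ->
  \int[P]_(x in V) (d k x)%:E = 0.
Hypothesis delta_atomwise : forall k, (1 <= k <= n)%N ->
  atomwise (D k.-1) (delta k).
Hypothesis d_le_delta : forall k x, (1 <= k <= n)%N -> (`|d k x| <= delta k x)%R.
Hypothesis delta_sum : forall x, (\sum_(1 <= k < n.+1) delta k x ^+ 2 <= s ^+ 2)%R.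

Let a : R := (3 / (8 * s ^+ 2))%R.
Let f k x : R := (\sum_(1 <= j < k.+1) d j x)%R.
Let c k x : R := (4^-1 + 2 * a * \sum_(1 <= j < k.+1) delta j x ^+ 2)%R.

Let a_gt0 : (0 < a)%R.
Proof. by rewrite divr_gt0// mulr_gt0// exprn_gt0. Qed.

Let f_atomwise k : (k <= n)%N -> atomwise (D k) (f k).
Proof.
move=> kn V x y DV Vx Vy; apply: eq_big_nat => j /andP[j1]; rewrite ltnS => jk.
apply: (atomwise_refine jk (d_atomwise _) DV) => //.
by rewrite j1 (leq_trans jk).
Qed.

(** Predictability: this is what allows [c k.+1] to be treated as a constant on each atom of
    [D k]. *)
Let c_atomwise k : (k <= n)%N -> atomwise (D k.-1) (c k).
Proof.
move=> kn V x y DV Vx Vy; rewrite /c; congr (_ + _ * _)%R.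
apply: eq_big_nat => j /andP[j1]; rewrite ltnS => jk; congr (_ ^+ 2)%R.
apply: (atomwise_refine _ (delta_atomwise _) DV) => //; last first.
  by rewrite j1 (leq_trans jk).
by case: (j) (k) j1 jk => [|j'] [|k'].
Qed.

Let c_gt0 k x : (0 < c k x)%R.
Proof.
rewrite /c ltr_wpDr ?invr_gt0// mulr_ge0//; last first.
  by apply: sumr_ge0 => j _; exact: sqr_ge0.
by rewrite mulr_ge0// ltW.
Qed.

Let c_le1 x : (c n x <= 1)%R.
Proof.
have /(ler_wpM2l (ltW a_gt0)) := delta_sum x.
have -> : (a * s ^+ 2 = 3 / 8)%R by rewrite /a; field; rewrite gt_eqF.
by rewrite /c => h; lra.
Qed.

Let u k x : \bar R := (gauss_evol a (f k x) (c k x))%:E.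

Let u_atomwise k : (k <= n)%N -> atomwise (D k) (u k).
Proof.
move=> kn V x y DV Vx Vy; rewrite /u (f_atomwise kn DV Vx Vy).
by rewrite (atomwise_refine (leq_pred k) (c_atomwise kn) DV Vx Vy).
Qed.

(** On an atom of [D k] the quantities [f k], [delta k.+1] and [c k.+1] are constants. The chord
    bounds [u k.+1] by an affine function of [d k.+1], the zero mean removes the linear term, and
    [gauss_evol_step] bounds the constant term by [u k]. *)
Let u_step k : (k < n)%N -> \int[P]_x u k.+1 x <= \int[P]_x u k x.
Proof.
move=> kn; have kn1 : (1 <= k.+1 <= n)%N by [].
apply: (@ge0_le_integral_partition _ _ _ P (D k) (filt_countable k) (filt_partition k)).
- exact: filt_measurable.
- exact: filt_measurable_fun (u_atomwise kn).
- exact: filt_measurable_fun (u_atomwise (ltnW kn)).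
- by move=> x; rewrite lee_fin gauss_evol_ge0.
- by move=> x; rewrite lee_fin gauss_evol_ge0.
move=> V DV; have mV := filt_measurable DV.
have [_ _ /(_ V DV)[z Vz]] := filt_partition k.
have cS x : c k.+1 x = (c k x + 2 * a * delta k.+1 x ^+ 2)%R.
  by rewrite /c big_nat_recr//= mulrDr addrA.
have fE x : V x -> f k x = f k z by move=> Vx; apply: (f_atomwise (ltnW kn) DV).
have deltaE x : V x -> delta k.+1 x = delta k.+1 z.
  by move=> Vx; apply: (delta_atomwise kn1 DV).
have cE x : V x -> c k.+1 x = c k.+1 z by move=> Vx; apply: (c_atomwise kn DV).
set y := f k z in fE *; set e := delta k.+1 z in deltaE; set C := c k.+1 z in cE.
pose b := (a / C)%R.
(* Midpoint height and slope of the chord over [y - e, y + e]. *)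
pose A := ((gauss_evol a (y + e) C + gauss_evol a (y - e) C) / 2)%R.
pose B := ((gauss_evol a (y + e) C - gauss_evol a (y - e) C) / (2 * e))%R.
have uB x : V x -> u k.+1 x <= (A + B * d k.+1 x)%:E.
  move=> Vx; rewrite /u lee_fin (cE x Vx) /f big_nat_recr//= -/(f k x) (fE x Vx).
  have de : (`|d k.+1 x| <= e)%R by rewrite -(deltaE x Vx) d_le_delta.
  have b0 : (0 <= b)%R by rewrite ltW// divr_gt0 ?c_gt0.
  have := expR_sq_chord y b0 de; rewrite -/b.
  have sq0 : (0 < Num.sqrt C)%R by rewrite sqrtr_gt0 c_gt0.
  rewrite -(ler_pM2r (x := (Num.sqrt C)^-1)) ?invr_gt0// => /le_trans; apply.
  by rewrite le_eqVlt; apply/orP; left; apply/eqP; rewrite /A /B /gauss_evol -/b; ring.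
have intd : P.-integrable V (EFin \o d k.+1).
  exact: integrableS (d_integrable kn1).
have mu1 : measurable_fun V (u k.+1).
  exact: measurable_funTS (filt_measurable_fun (u_atomwise kn)).
have AB : \int[P]_(x in V) (A + B * d k.+1 x)%:E = A%:E * P V.
  under eq_integral do rewrite EFinD EFinM.
  have iA : P.-integrable V (fun=> A%:E) by exact: finite_measure_integrable_cst.
  rewrite (integralD mV iA (integrableZl mV B intd)).
  by rewrite integralZl// d_mean0// mule0 adde0 integral_cst.
(* The increment from [c k] to [c k.+1] is exactly 2 a e^2 on [V]. *)
have uV x : V x -> u k x = (gauss_evol a y (C - 2 * a * e ^+ 2))%:E.
  move=> Vx; rewrite /u fE//; congr (gauss_evol _ _ _)%:E.
  by rewrite -(cE x Vx) cS (deltaE x Vx) addrK.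
have -> : \int[P]_(x in V) u k x =
    (gauss_evol a y (C - 2 * a * e ^+ 2))%:E * P V.
  rewrite -integral_cst//; apply: eq_integral => x; rewrite inE => Vx.
  by rewrite uV.
apply: (@le_trans _ _ (A%:E * P V)); last first.
  rewrite lee_wpmul2r// lee_fin gauss_evol_step//.
  by rewrite -subr_gt0 /C cS addrK.
rewrite -AB; apply: ge0_le_integral => //.
- by move=> x _; rewrite lee_fin gauss_evol_ge0.
- apply/measurable_EFinP; apply: measurable_funD => //.
  by apply: measurable_funM => //; case/integrableP: intd => /measurable_EFinP.
Qed.

Lemma integral_expR_sqr_le2 :
  \int[P]_x (expR (3 / (8 * s ^+ 2) * (\sum_(1 <= j < n.+1) d j x) ^+ 2))%:E <= 2%:E.
Proof.
have u2 k : (k <= n)%N -> \int[P]_x u k x <= 2%:E.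
  elim: k => [_|k IH kn]; last exact: le_trans (u_step kn) (IH (ltnW kn)).
  (* For k = 0 the sums are empty and 1 / sqrt(1/4) = 2. *)
  rewrite (eq_integral (cst 2%:E)); last first.
    move=> x _; rewrite /u /f /c /gauss_evol !big_geq// expr0n/= !mulr0 addr0 expR0.
    rewrite (_ : 4^-1 = (2^-1) ^+ 2 :> R)%R; last by field.
    by rewrite sqrtr_sqr ger0_norm// invrK mul1r.
  by rewrite integral_cst_probability.
apply: le_trans (u2 n (leqnn n)); apply: ge0_le_integral => //.
- apply: (@filt_measurable_fun n).
  apply: (atomwise_comp (fun t => (expR (3 / (8 * s ^+ 2) * t ^+ 2))%:E)).
  exact: f_atomwise.
- exact: filt_measurable_fun (u_atomwise (leqnn n)).
- by move=> x _; rewrite lee_fin gauss_evol_anti// ltW.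
Qed.

End supermartingale.

(** For u = sqrt(8/3) s one has (f / u)^2 = 3 f^2 / (8 s^2), so u is admissible by the exponential
    bound 2, from which the total mass 1 is subtracted. *)
Lemma luxemburg_norm_le d n s : (0 < s)%R -> martingale_difference P D n d ->
  Lnorm P +oo (square_function P D n d) <= s%:E ->
  luxemburg_norm P (@psi_exp2 R) (fun x => \sum_(1 <= k < n.+1) d k x)%R
    <= (Num.sqrt (8 / 3) * s)%:E.
Proof.
move=> s0 md Ss; pose maj := predictable_majorant P D d.
have sum_le x := sum_sqr_majorant_le x (ltW s0) Ss.
(* An infinite majorant would make the sum of squares infinite; hence [fine] loses nothing for these
   indices. *)
have maj_fin k x : (1 <= k <= n)%N -> maj k x \is a fin_num.
  move=> /andP[k1 kn]; rewrite ge0_fin_numE ?predictable_majorant_ge0//.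
  rewrite ltey; apply/eqP => moo; have := sum_le x.
  rewrite (bigD1_seq k)/= ?mem_index_iota ?k1 ?iota_uniq//.
  rewrite -/maj moo; apply/negP; rewrite -ltNge.
  rewrite mulyy addye ?ltry// gt_eqF// (lt_le_trans (ltNyr 0))//.
  by apply: sume_ge0 => j _; rewrite sqre_ge0.
have d_atom k : (1 <= k <= n)%N -> atomwise (D k) (d k).
  move=> /md[_ mdk _].
  exact: (g_sigma_measurable_atomwise (filt_partition k) mdk).
apply: ereal_inf_lbound; exists (Num.sqrt (8 / 3) * s)%R => //; split.
  by rewrite mulr_gt0// sqrtr_gt0.
have bound : \int[P]_x (expR (3 / (8 * s ^+ 2) *
    (\sum_(1 <= j < n.+1) d j x) ^+ 2))%:E <= 2%:E.
  apply: (@integral_expR_sqr_le2 d (fun k x => fine (maj k x)) n s s0) => //.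
  - by move=> k /md[].
  - by move=> k V /md[_ _]; exact.
  - move=> k _; apply: (atomwise_comp fine).
    exact: predictable_majorant_atomwise.
  - move=> k x kn; rewrite -lee_fin fineK ?maj_fin// normr_le_majorant//.
    exact: d_atom.
  - move=> x; rewrite -lee_fin -sumEFin; apply: le_trans (sum_le x).
    rewrite le_eqVlt; apply/orP; left; apply/eqP; apply: eq_big_nat => k kn.
    by rewrite EFin_expe fineK// maj_fin.
rewrite expectation.unlock; set psi := fun x : T => _.
have psi0 x : 0 <= psi x.
  by rewrite lee_fin /psi_exp2 subr_ge0 -expR0 ler_expR sqr_ge0.
have mpsi : measurable_fun [set: T] psi.
  apply: (@filt_measurable_fun n).
  apply: (atomwise_comp (fun t => (psi_exp2 (t / (Num.sqrt (8 / 3) * s)))%:E)).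
  move=> V x y DV Vx Vy; apply: eq_big_nat => j /andP[j1]; rewrite ltnS => jk.
  by apply: (atomwise_refine jk (d_atom _ _) DV) => //; rewrite j1.
have : \int[P]_x (psi x + 1) <= 2%:E.
  apply: le_trans bound; rewrite le_eqVlt; apply/orP; left; apply/eqP.
  apply: eq_integral => x _; rewrite /psi /psi_exp2 -EFinD subrK.
  congr (expR _)%:E; rewrite !exprMn exprVn exprMn sqr_sqrtr; last by lra.
  by field; rewrite gt_eqF.
rewrite ge0_integralD// integral_cst_probability.
by rewrite -leeBrDr// -EFinB (_ : 2 - 1 = 1 :> R)%R//; lra.
Qed.

(** If the norm [N] of the square function is infinite, so is the right side. Otherwise s = N + e /
    K is positive even for N = 0, and e > 0 is arbitrary. *)
Lemma luxemburg_norm_le_square_function d n : martingale_difference P D n d ->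
  luxemburg_norm P (@psi_exp2 R) (fun x => \sum_(1 <= k < n.+1) d k x)%R
    <= (Num.sqrt (8 / 3))%:E * Lnorm P +oo (square_function P D n d).
Proof.
move=> md; set N := Lnorm _ _ _; set K := Num.sqrt (8 / 3).
have K0 : (0 < K)%R by rewrite sqrtr_gt0; lra.
have N0 : 0 <= N by exact: Lnorm_ge0.
have [Nfin|] := boolP (N \is a fin_num); last first.
  rewrite ge0_fin_numE// -leNgt leye_eq => /eqP ->.
  by rewrite gt0_muley ?lte_fin// leey.
apply/lee_addgt0Pr => e e0; rewrite -(fineK Nfin) -EFinM -EFinD.
rewrite (_ : _ + e = K * (fine N + e / K))%R; last by field; rewrite gt_eqF.
apply: luxemburg_norm_le => //; first by rewrite ltr_wpDl ?divr_gt0 ?fine_ge0.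
by rewrite -[leLHS](fineK Nfin) lee_fin lerDl divr_ge0// ltW.
Qed.

End upper.

(** * Rademacher sums and sharpness *)

Section central_series.
Variable R : realType.

(** The double factorial (2j-1)!!, which is the moment of order 2j of a standard Gaussian. *)
Definition odd_fact j : R := \prod_(i < j) (2 * i + 1)%:R.

(** Equal to C(2j, j), in a form that displays the factor supplied by the moment bound. *)
Definition central_coef j : R := 2 ^+ j * odd_fact j / j`!%:R.

Lemma odd_factS j : odd_fact j.+1 = (2 * j%:R + 1) * odd_fact j.
Proof. by rewrite /odd_fact big_ord_recr/= mulrC natrD natrM. Qed.

Lemma odd_fact_ge0 j : 0 <= odd_fact j.
Proof. by rewrite prodr_ge0. Qed.

Lemma central_coef0 : central_coef 0 = 1.
Proof. by rewrite /central_coef /odd_fact big_ord0 expr0 fact0 mulr1 divr1. Qed.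

Lemma central_coef_ge0 j : 0 <= central_coef j.
Proof. by rewrite divr_ge0// mulr_ge0 ?odd_fact_ge0 ?exprn_ge0. Qed.

Lemma central_coefS j :
  (j%:R + 1) * central_coef j.+1 = (4 * j%:R + 2) * central_coef j.
Proof.
rewrite /central_coef odd_factS factS natrM exprS -natr1.
have f0 : j`!%:R != 0 :> R by rewrite pnatr_eq0 -lt0n fact_gt0.
have j0 : j%:R + 1 != 0 :> R by rewrite gt_eqF// ltr_wpDl.
by field; rewrite f0 addrC j0.
Qed.

(** Let T be the convolution and U the same sum weighted by i. The symmetry i -> m - i gives 2 U(m)
    = m T(m), the recurrence [central_coefS] gives U(m+1) = 4 U(m) + 2 T(m), and together T(m+1) = 4
    T(m). *)
Lemma central_coef_convolution k :
  \sum_(i < k.+1) central_coef i * central_coef (k - i) = 4 ^+ k.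
Proof.
set cc := central_coef.
have ccS m : (m%:R + 1) * cc m.+1 = (4 * m%:R + 2) * cc m := central_coefS m.
pose T k := \sum_(i < k.+1) cc i * cc (k - i)%N.
pose U k := \sum_(i < k.+1) i%:R * (cc i * cc (k - i)%N).
have UT m : 2 * U m = m%:R * T m.
  have Urev : U m = \sum_(i < m.+1) (m - i)%:R * (cc i * cc (m - i)%N).
    rewrite /U (reindex_inj rev_ord_inj)/=; apply: eq_bigr => i _.
    by rewrite subSS subKn -1?ltnS// [cc _ * cc i]mulrC.
  rewrite mulr_natl mulr2n {2}Urev -big_split/= mulr_sumr.
  apply: eq_bigr => i _; rewrite -mulrDl -natrD subnKC//.
  by rewrite -ltnS.
have US m : U m.+1 = 4 * U m + 2 * T m.
  rewrite /U big_ord_recl/= mul0r add0r !mulr_sumr -big_split/=.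
  apply: eq_bigr => i _; rewrite /bump/= add1n subSS mulrA -natr1.
  by rewrite ccS; ring.
suff TE m : T m = 4 ^+ m by rewrite -TE.
elim: m => [|m IH].
  by rewrite /T big_ord1 /cc subnn central_coef0 mulr1 expr0.
have m0 : m.+1%:R != 0 :> R by rewrite pnatr_eq0.
apply: (mulfI m0); rewrite -UT US mulrDr mulrCA UT IH exprS -natr1.
by ring.
Qed.

(** Of the products a_i a_j in the square, the left side keeps those with i + j < M. *)
Lemma sqr_sum_ge_convolution (a : nat -> R) M : (forall i, 0 <= a i) ->
  \sum_(k < M) \sum_(i < k.+1) a i * a (k - i)%N <= (\sum_(i < M) a i) ^+ 2.
Proof.
move=> a0; pose S m := \sum_(i < m) a i.
have SS m : S m.+1 = S m + a m by rewrite /S big_ord_recr.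
have -> : \sum_(k < M) \sum_(i < k.+1) a i * a (k - i)%N =
    \sum_(i < M) a i * S (M - i)%N.
  elim: (M) => [|m IH]; first by rewrite !big_ord0.
  rewrite big_ord_recr/= IH [RHS](eq_bigr
    (fun i : 'I_m.+1 => a i * S (m - i)%N + a i * a (m - i)%N)).
    by rewrite big_split/= [in RHS]big_ord_recr/= subnn /S big_ord0 mulr0 addr0.
  by move=> i _; rewrite subSn -1?ltnS// SS mulrDr.
rewrite expr2 mulr_suml; apply: ler_sum => i _; rewrite ler_wpM2l//.
have Sm : {homo S : x y / (x <= y)%N >-> x <= y}.
  by apply: homo_leq => // [x y z|m]; [exact: le_trans|rewrite SS lerDl].
exact: Sm (leq_subr _ _).
Qed.

(** The square of the partial sum is at least (1 - t^M) / (1 - t), which exceeds 4 once t^M < 4 t -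
    3. *)
Lemma central_series_gt2 (t : R) : 3 / 4 < t < 1 ->
  exists M, 2 < \sum_(j < M) central_coef j * (t / 4) ^+ j.
Proof.
move=> /andP[t34 t1]; have t0 : 0 < t by lra.
have [M tM] : exists M, t ^+ M < 4 * t - 3.
  have t_cvg : t ^+ n @[n --> \oo] --> 0 by apply: cvg_expr; rewrite gtr0_norm.
  have e0 : 0 < 4 * t - 3 by lra.
  move/cvgrPdist_lt : t_cvg => /(_ _ e0)[M _ /(_ M (leqnn M))].
  by rewrite /= sub0r normrN gtr0_norm ?exprn_gt0// => h; exists M.
exists M; rewrite -ltr_sqr ?nnegrE//; last first.
  by apply: sumr_ge0 => j _; rewrite mulr_ge0 ?central_coef_ge0// exprn_ge0//; lra.
have := @sqr_sum_ge_convolution (fun j => central_coef j * (t / 4) ^+ j) M.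
move=> h; apply: lt_le_trans (h _); last first.
  by move=> j; rewrite mulr_ge0 ?central_coef_ge0// exprn_ge0//; lra.
rewrite (eq_bigr (fun k : 'I_M => t ^+ k)); last first.
  move=> k _; rewrite (eq_bigr (fun i : 'I_k.+1 =>
    central_coef i * central_coef (k - i) * (t / 4) ^+ k)); last first.
    by move=> i _; rewrite mulrACA -exprD subnKC// -ltnS.
  by rewrite -mulr_suml central_coef_convolution -exprMn; congr (_ ^+ _); field.
have : (1 - t) * \sum_(k < M) t ^+ k = 1 - t ^+ M.
  by have := subrX1 t M => E; rewrite -[RHS]opprB E -mulNr opprB.
move=> E; rewrite -(ltr_pM2l (x := 1 - t)); last lra.
by rewrite E; lra.
Qed.

(** Passing from j to j + 1 multiplies the ratio by 1 - j/n, which costs at most j/n because the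
    ratio is at most 1; the two bounds are therefore proved together. *)
Lemma ffact_ratio_ge n j : (0 < n)%N ->
  (1 : R) - j%:R ^+ 2 / n%:R <= (n ^_ j)%:R / n%:R ^+ j <= (1 : R).
Proof.
move=> n0; have nR : 0 < n%:R :> R by rewrite ltr0n.
elim: j => [|j /andP[IH1 IH2]].
  by rewrite ffactn0 expr0 divr1 expr0n/= mul0r subr0 lexx.
have [jn|nj] := leqP j n; last first.
  rewrite ffact_small ?mul0r ?ler01 ?andbT; last by rewrite ltnS ltnW.
  rewrite subr_le0 ler_pdivlMr// mul1r -natrX ler_nat.
  by rewrite (leq_trans (ltnW nj))// (leq_trans (leqnSn j))// expnS expn1 leq_pmulr.
have -> : (n ^_ j.+1)%:R / n%:R ^+ j.+1 =
    (n ^_ j)%:R / n%:R ^+ j * (1 - j%:R / n%:R) :> R.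
  rewrite ffactnSr natrM natrB// exprS.
  have nj0 : n%:R ^+ j != 0 :> R by rewrite expf_neq0// gt_eqF.
  by field; rewrite nj0 gt_eqF.
set rho := (n ^_ j)%:R / _ in IH1 IH2 *.
have rho0 : 0 <= rho by rewrite divr_ge0.
set x := j%:R / n%:R.
have x0 : 0 <= x by rewrite divr_ge0.
have x1 : x <= 1 by rewrite ler_pdivrMr// mul1r ler_nat.
have -> : j.+1%:R ^+ 2 / n%:R = j%:R ^+ 2 / n%:R + 2 * x + n%:R^-1 :> R.
  by rewrite /x -natr1; field; rewrite gt_eqF.
have n1 : 0 <= n%:R^-1 :> R by rewrite invr_ge0.
have rx1 : rho * x <= x by rewrite ler_piMl.
have rx0 : 0 <= rho * x by rewrite mulr_ge0.
by rewrite mulrBr mulr1; apply/andP; split; lra.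
Qed.

Lemma falling_series_gt2 (t : R) : 3 / 4 < t < 1 ->
  exists M n, (0 < n)%N /\
  2 < \sum_(j < M) central_coef j * (t / 4) ^+ j * ((n ^_ j)%:R / n%:R ^+ j).
Proof.
move=> t01; have [M] := central_series_gt2 t01.
set A := \sum_(j < M) _ => A2; exists M.
(* Each term keeps at least the fraction 1 - M^2 / n, and this choice gives A (1 - M^2 / n) > 2. *)
pose n := (Num.truncn (A * M%:R ^+ 2 / (A - 2))).+1; exists n; split => //.
have nR : 0 < n%:R :> R by rewrite ltr0n.
have nA : A * M%:R ^+ 2 / (A - 2) < n%:R by rewrite /n truncnS_gt.
apply: (@lt_le_trans _ _ (A * (1 - M%:R ^+ 2 / n%:R))).
  rewrite mulrBr mulr1 mulrA ltrBrDr -ltrBrDl ltr_pdivrMr//.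
  by rewrite [ltRHS]mulrC -ltr_pdivrMr// subr_gt0.
rewrite mulr_suml; apply: ler_sum => j _; rewrite ler_wpM2l//.
  by rewrite mulr_ge0 ?central_coef_ge0// exprn_ge0//; lra.
have /andP[h _] := @ffact_ratio_ge n j isT; apply: le_trans h.
rewrite lerD2l lerN2 ler_pM2r ?invr_gt0// ler_sqr ?nnegrE// ler_nat.
exact: ltnW.
Qed.

End central_series.

(** * Moments of Rademacher sums *)

Section rademacher.
Variable R : realType.

(* [rademacher k i] is the sign attached to the k-th binary digit of i. *)
Definition rademacher k i : R := (-1) ^+ (i %/ 2 ^ k).

Definition rademacher_sum n i : R := \sum_(k < n) rademacher k i.

(** Removing a multiple of 2^(k+1) changes the quotient by an even number. *)
Lemma rademacher_mod k i : rademacher k i = rademacher k (i %% 2 ^ k.+1).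
Proof.
rewrite /rademacher {1}(divn_eq i (2 ^ k.+1)).
move: (i %/ 2 ^ k.+1)%N => q; rewrite {1}expnS mulnA.
by rewrite divnMDl ?expn_gt0// exprD mulnC exprM sqrrN !expr1n mul1r.
Qed.

Lemma sum_pow2S (V : nmodType) n (F : nat -> V) :
  \sum_(i < 2 ^ n.+1) F i = \sum_(i < 2 ^ n) (F i + F (2 ^ n + i)%N).
Proof. by rewrite expnS mul2n -addnn big_split_ord big_split. Qed.

Lemma rademacher_lt k i : (i < 2 ^ k)%N -> rademacher k i = 1.
Proof. by move=> ik; rewrite /rademacher divn_small. Qed.

Lemma rademacher_add k n i : (k < n)%N ->
  rademacher k (2 ^ n + i) = rademacher k i.
Proof.
move=> kn; rewrite /rademacher -(subnK (ltnW kn)) expnD divnMDl ?expn_gt0//.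
have [m ->] : exists m, (n - k = m.+1)%N by exists (n - k).-1; rewrite prednK ?subn_gt0.
by rewrite exprD expnS exprM sqrrN !expr1n mul1r.
Qed.

Lemma rademacher_top n i : (i < 2 ^ n)%N -> rademacher n (2 ^ n + i) = -1.
Proof.
move=> i_n; rewrite /rademacher -{1}[(2 ^ n)%N]mul1n divnMDl ?expn_gt0//.
by rewrite divn_small// addn0 expr1.
Qed.

Lemma sum_rademacher_sum n (g : R -> R) :
  \sum_(i < 2 ^ n.+1) g (rademacher_sum n.+1 i) =
  \sum_(i < 2 ^ n) (g (rademacher_sum n i + 1) + g (rademacher_sum n i - 1)).
Proof.
rewrite (sum_pow2S n (fun i => g (rademacher_sum n.+1 i))).
apply: eq_bigr => i _; rewrite /rademacher_sum !big_ord_recr/=.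
rewrite rademacher_lt// rademacher_top//; congr (_ + g (_ + _)).
by apply: eq_bigr => k _; rewrite rademacher_add.
Qed.

(** [g] sees only the digits below k, while flipping digit k reverses the sign, so the terms cancel
    in pairs. *)
Lemma sum_rademacher_eq0 k n (g : nat -> R) : (k < n)%N ->
  (forall i, g i = g (i %% 2 ^ k)%N) ->
  \sum_(i < 2 ^ n) g i * rademacher k i = 0.
Proof.
move=> + gk; have gD m i : (k <= m)%N -> g (2 ^ m + i)%N = g i.
  by move=> km; rewrite gk -modnDml (eqP (dvdn_exp2l 2 km)) add0n -gk.
elim: n => // n IH; rewrite ltnS leq_eqVlt => /orP[/eqP kn|kn];
    rewrite (sum_pow2S n (fun i => g i * rademacher k i)).
  rewrite big1// => i _; rewrite gD ?kn// rademacher_lt ?rademacher_top//.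
  by rewrite mulr1 mulrN1 subrr.
rewrite big_split/= [X in _ + X](eq_bigr (fun i : 'I__ => g i * rademacher k i)).
  by rewrite IH// addr0.
by move=> i _; rewrite gD ?rademacher_add// ltnW.
Qed.

(** Since (j+1)(2j+1) = C(2j+2, 2), the left side consists of the two leading terms of the binomial
    expansion of the right side. *)
Lemma even_pow_shift_ge (x : R) j :
  2 * (x ^+ (2 * j.+1) + (j.+1%:R * (2 * j%:R + 1)) * x ^+ (2 * j)) <=
  (x + 1) ^+ (2 * j.+1) + (x - 1) ^+ (2 * j.+1).
Proof.
rewrite !exprM; set y := x ^+ 2; set p := (x + 1) ^+ 2; set m := (x - 1) ^+ 2.
have y0 : 0 <= y := sqr_ge0 x.
have pE : p = y + 1 + 2 * x by rewrite /p /y; ring.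
have mE : m = y + 1 - 2 * x by rewrite /m /y; ring.
(* The odd part x (p^j - m^j) has to be carried along the induction. *)
suff [] : 2 * (y ^+ j.+1 + (j.+1%:R * (2 * j%:R + 1)) * y ^+ j) <=
    p ^+ j.+1 + m ^+ j.+1 /\
    4 * j.+1%:R * y ^+ j.+1 <= x * (p ^+ j.+1 - m ^+ j.+1) by [].
elim: j => [|j [IH1 IH2]].
  by rewrite !expr1 expr0 pE mE /y; split; lra.
have eE : p ^+ j.+2 + m ^+ j.+2 =
    (y + 1) * (p ^+ j.+1 + m ^+ j.+1) + 2 * (x * (p ^+ j.+1 - m ^+ j.+1)).
  by rewrite !(exprS _ j.+1) {1}pE {1}mE; ring.
have oE : x * (p ^+ j.+2 - m ^+ j.+2) =
    (y + 1) * (x * (p ^+ j.+1 - m ^+ j.+1)) + 2 * y * (p ^+ j.+1 + m ^+ j.+1).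
  by rewrite !(exprS _ j.+1) {1}pE {1}mE /y; ring.
have yj : 0 <= y ^+ j by rewrite exprn_ge0.
have y1 : 0 <= y + 1 by rewrite addr_ge0.
have h1 := ler_wpM2l y1 IH1; have h2 := ler_wpM2l y1 IH2.
have h3 := ler_wpM2l (mulr_ge0 (ler0n R 2) y0) IH1.
rewrite eE oE; split.
  apply: le_trans (lerD h1 (ler_wpM2l (ler0n R 2) IH2)).
  have -> : j.+2%:R = j%:R + 2 :> R by rewrite -addn2 natrD.
  have -> : j.+1%:R = j%:R + 1 :> R by rewrite -natr1.
  rewrite (exprS _ j.+1) (exprS _ j) -subr_ge0.
  set J : R := j%:R; have J0 : 0 <= J by rewrite /J.
  have -> : (y + 1) * (2 * (y * y ^+ j + (J + 1) * (2 * J + 1) * y ^+ j)) +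
    2 * (4 * (J + 1) * (y * y ^+ j)) -
    2 * (y * (y * y ^+ j) + (J + 2) * (2 * (J + 1) + 1) * (y * y ^+ j)) =
    2 * (J + 1) * (2 * J + 1) * y ^+ j by ring.
  by rewrite !mulr_ge0//; lra.
apply: le_trans (lerD h2 h3).
have -> : j.+2%:R = j%:R + 2 :> R by rewrite -addn2 natrD.
have -> : j.+1%:R = j%:R + 1 :> R by rewrite -natr1.
rewrite (exprS _ j.+1) (exprS _ j) -subr_ge0.
set J : R := j%:R; have J0 : 0 <= J by rewrite /J.
have -> : (y + 1) * (4 * (J + 1) * (y * y ^+ j)) +
  2 * y * (2 * (y * y ^+ j + (J + 1) * (2 * J + 1) * y ^+ j)) -
  4 * (J + 2) * (y * (y * y ^+ j)) =
  4 * (J + 1) * (y * y ^+ j) + 4 * (J + 1) * (2 * J + 1) * (y * y ^+ j) by ring.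
move: (y * y ^+ j) (mulr_ge0 y0 yj) => z z0.
by rewrite addr_ge0// !mulr_ge0//; lra.
Qed.

(** Adding a sign raises the moment of order 2j+2 by at least (j+1)(2j+1) times that of order 2j.
    This matches the recurrence (n+1)_(j+1) = n_(j+1) + (j+1) n_j of falling factorials. *)
Lemma rademacher_moment_ge n j :
  odd_fact R j * (n ^_ j)%:R <=
  2 ^- n * \sum_(i < 2 ^ n) rademacher_sum n i ^+ (2 * j).
Proof.
elim: n j => [|n IH] [|j].
- by rewrite /odd_fact big_ord0 ffactn0 expr0 big_ord1 expr0 invr1 !mulr1.
- rewrite ffact0n mulr0 mulr_ge0 ?invr_ge0 ?exprn_ge0// sumr_ge0// => i _.
  by rewrite exprM exprn_ge0// sqr_ge0.
- under eq_bigr do rewrite expr0.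
  rewrite sumr_const card_ord natrX mulVf ?expf_neq0//.
  by rewrite /odd_fact big_ord0 ffactn0 mulr1.
rewrite (sum_rademacher_sum n (fun x => x ^+ (2 * j.+1))).
have step : 2 * (2 ^- n * \sum_(i < 2 ^ n) rademacher_sum n i ^+ (2 * j.+1) +
    (j.+1%:R * (2 * j%:R + 1)) *
      (2 ^- n * \sum_(i < 2 ^ n) rademacher_sum n i ^+ (2 * j))) <=
    2 ^- n * \sum_(i < 2 ^ n) ((rademacher_sum n i + 1) ^+ (2 * j.+1) +
    (rademacher_sum n i - 1) ^+ (2 * j.+1)).
  rewrite mulrCA -mulrDr mulrCA ler_wpM2l ?invr_ge0 ?exprn_ge0//.
  rewrite mulr_sumr -big_split/= mulr_sumr; apply: ler_sum => i _.
  exact: even_pow_shift_ge.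
rewrite exprS invfM -mulrA -[leLHS](@mulKf _ 2)// ler_pM2l ?invr_gt0//.
apply: le_trans step; rewrite ler_pM2l//.
apply: le_trans (lerD (IH j.+1) (ler_wpM2l _ (IH j))); last first.
  by rewrite mulr_ge0// addr_ge0// mulr_ge0.
rewrite odd_factS.
have -> : (n.+1 ^_ j.+1)%:R = (n ^_ j.+1)%:R + j.+1%:R * (n ^_ j)%:R :> R.
  rewrite -natrM -natrD ffactSS ffactnSr; congr (_%:R).
  have [jn|nj] := leqP j n; last by rewrite ffact_small// !muln0 mul0n.
  by rewrite mulnC [(j.+1 * _)%N]mulnC -mulnDr addnS subnK.
by rewrite le_eqVlt; apply/orP; left; apply/eqP; ring.
Qed.

(** Truncating the exponential series after M terms leaves a combination of even moments with
    nonnegative coefficients. *)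
Lemma rademacher_expR_gt2 (t : R) : 3 / 4 < t < 1 -> exists n, (0 < n)%N /\
  2 < 2 ^- n * \sum_(i < 2 ^ n) expR (t / 2 * rademacher_sum n i ^+ 2 / n%:R).
Proof.
move=> t01; have t0 : 0 < t by lra.
have [M [n [n0 gt2]]] := falling_series_gt2 t01; exists n; split=> //.
have nR : 0 < n%:R :> R by rewrite ltr0n.
apply: lt_le_trans gt2 _.
apply: (@le_trans _ _ (\sum_(j < M) (t / 2 / n%:R) ^+ j / j`!%:R *
    (2 ^- n * \sum_(i < 2 ^ n) rademacher_sum n i ^+ (2 * j)))).
  apply: ler_sum => j _.
  have cj : 0 <= (t / 2 / n%:R) ^+ j / j`!%:R.
    by rewrite divr_ge0// exprn_ge0// !divr_ge0// ltW.
  apply: le_trans (ler_wpM2l cj (rademacher_moment_ge n j)).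
  rewrite /central_coef le_eqVlt; apply/orP; left; apply/eqP.
  have f0 : j`!%:R != 0 :> R by rewrite pnatr_eq0 -lt0n fact_gt0.
  have -> : t / 4 = t / 2 / 2 by field.
  rewrite !exprMn !exprVn; field.
  by rewrite f0 !expf_neq0// gt_eqF.
under eq_bigr do rewrite mulrCA mulr_sumr.
rewrite -mulr_sumr ler_wpM2l ?invr_ge0 ?exprn_ge0// exchange_big/=.
apply: ler_sum => i _; set x := rademacher_sum n i.
have -> : t / 2 * x ^+ 2 / n%:R = t / 2 / n%:R * x ^+ 2 by rewrite mulrAC.
have y0 : 0 <= t / 2 / n%:R * x ^+ 2.
  by rewrite mulr_ge0 ?sqr_ge0// !divr_ge0// ltW.
apply: le_trans (series_exp_coeff_le M y0).
rewrite /series/= big_mkord le_eqVlt; apply/orP; left; apply/eqP.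
by apply: eq_bigr => j _; rewrite /exp_coeff/= [in RHS]exprMn exprM mulrAC.
Qed.

End rademacher.

(** * The extremal example: independent fair bits *)

Section uniform_bits.
Variables (R : realType) (n : nat).
Local Open Scope ereal_scope.

Definition bit_weight : {nonneg R} := ((2 ^- n)%:nng)%R.

(** The uniform law on 0, ..., 2^n - 1 lives on all of nat, where every function is measurable;
    larger integers have mass zero. *)
Definition uniform_bits : set nat -> \bar R :=
  msum (fun i => mscale bit_weight \d_i) (2 ^ n).

HB.instance Definition _ := Measure.on uniform_bits.

Lemma uniform_bitsE A : uniform_bits A =
  (2 ^- n * \sum_(i < 2 ^ n) \1_A (i : nat))%:E.
Proof.
rewrite /uniform_bits /msum/= /mscale/= mulr_sumr -sumEFin.
by apply: eq_bigr => i _; rewrite diracE EFinM indicE.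
Qed.

Lemma uniform_bits_setT : uniform_bits [set: nat] = 1.
Proof.
rewrite uniform_bitsE; congr (_%:E).
under eq_bigr do rewrite indicT.
by rewrite sumr_const card_ord natrX mulVf// expf_neq0.
Qed.

HB.instance Definition _ :=
  Measure_isProbability.Build _ _ _ uniform_bits uniform_bits_setT.

Lemma measurable_fun_nat disp (U : measurableType disp) (A : set nat)
  (f : nat -> U) : measurable_fun A f.
Proof. by []. Qed.

Lemma ge0_integral_uniform_bits (A : set nat) (f : nat -> R) :
  (forall i, 0 <= f i)%R ->
  \int[uniform_bits]_(i in A) (f i)%:E =
    (2 ^- n * \sum_(i < 2 ^ n) \1_A (i : nat) * f i)%:E.
Proof.
move=> f0; have f0E x : A x -> (0 <= (f x)%:E)%E by rewrite lee_fin.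
rewrite ge0_integral_measure_sum//.
rewrite mulr_sumr -sumEFin; apply: eq_bigr => i _.
by rewrite ge0_integral_mscale// integral_dirac//.
Qed.

Lemma integral_uniform_bits (A : set nat) (f : nat -> R) :
  \int[uniform_bits]_(i in A) (f i)%:E =
    (2 ^- n * \sum_(i < 2 ^ n) \1_A (i : nat) * f i)%:E.
Proof.
rewrite integralE.
have -> : funepos (EFin \o f) = EFin \o (fun i => Num.max (f i) 0)%R.
  by exact: funerpos.
have -> : funeneg (EFin \o f) = EFin \o (fun i => Num.max (- f i) 0)%R.
  by exact: funerneg.
rewrite !ge0_integral_uniform_bits => [|i|i]; rewrite ?le_max ?lexx ?orbT//.
rewrite -EFinB -mulrBr -sumrB; congr (_ * _)%:E; apply: eq_bigr => i _.
rewrite -mulrBr; congr (_ * _)%R; have [f0|f0] := leP 0%R (f i).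
  by rewrite max_r ?oppr_le0// subr0.
by rewrite max_l ?oppr_ge0 ?ltW// opprK add0r.
Qed.

Lemma integrable_uniform_bits (f : nat -> R) :
  uniform_bits.-integrable [set: nat] (EFin \o f).
Proof.
apply/integrableP; split; first exact: measurable_fun_nat.
by rewrite (integral_uniform_bits _ (fun x => `|f x|%R)) ltry.
Qed.

(** An atom fixes the k lowest digits. The cap [minn k n] keeps every atom of positive mass: modulo
    a higher power of 2, some classes would avoid 0, ..., 2^n - 1. *)
Definition residue_classes k : set (set nat) :=
  range (fun r => [set i | i %% 2 ^ minn k n = r %% 2 ^ minn k n]%N).

Lemma residue_classes_partition k : partition (residue_classes k) id [set: nat].
Proof.
split.
- apply/seteqP; split=> // i _.
  by exists [set j | j %% 2 ^ minn k n = i %% 2 ^ minn k n]%N => //; exists i.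
- by move=> _ _ [r _ <-] [s _ <-] [i /= [ir is_]]; rewrite -ir is_.
- by move=> _ [r _ <-]; exists r.
Qed.

Lemma residue_classes_countable k : countable (residue_classes k).
Proof. exact: card_image_le. Qed.

Lemma residue_classes_filtration :
  discrete_filtration uniform_bits residue_classes.
Proof.
split.
- rewrite /residue_classes min0n expn0; apply/seteqP; split.
    by move=> _ [r _ <-]/=; apply/seteqP; split=> // i _; rewrite /= !modn1.
  move=> _ ->; exists 0%N => //; apply/seteqP; split=> // i _.
  by rewrite /= !modn1.
- by move=> k; split; [exact: residue_classes_countable|
    exact: residue_classes_partition].
- move=> k _ [r _ <-]; split=> //=.
  set V := [set _ | _].
  (* The class of r contains r mod 2^n, a point that carries weight. *)
  have rn : (r %% 2 ^ n < 2 ^ n)%N by rewrite ltn_mod expn_gt0.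
  have Vr : V (Ordinal rn : nat).
    by rewrite /V/= modn_dvdm// dvdn_exp2l// geq_minr.
  rewrite [X in 0 < X]uniform_bitsE lte_fin mulr_gt0//.
  rewrite (bigD1 (Ordinal rn))//= ltr_wpDr//; last by rewrite indicE mem_set.
  by apply: sumr_ge0 => i _; rewrite indicE.
- move=> k _ [r _ <-]; set V := [set _ | _].
  exists [set W | residue_classes k.+1 W /\ W `<=` V]; first by move=> W [].
  apply/seteqP; split=> [i Vi|i [W [_ WV] Wi]]; last exact: WV.
  exists [set j | j %% 2 ^ minn k.+1 n = i %% 2 ^ minn k.+1 n]%N => //.
  split; first by exists i.
  have dvd : (2 ^ minn k n %| 2 ^ minn k.+1 n)%N.
    by rewrite dvdn_exp2l// leq_min geq_minr andbT (leq_trans (geq_minl _ _)).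
  move=> j /= ji; rewrite /V/= -(modn_dvdm j dvd) ji modn_dvdm//; exact: Vi.
Qed.

(** Differences are numbered from 1, binary digits from 0. *)
Definition rademacher_diff k i : R := rademacher R k.-1 i.

(** Digit k - 1 is determined by the residue modulo 2^k, and the indicator of an atom of level k - 1
    depends only on lower digits, so [sum_rademacher_eq0] applies. *)
Lemma rademacher_diff_martingale :
  martingale_difference uniform_bits residue_classes n rademacher_diff.
Proof.
move=> k /andP[k1 kn]; have kE : k = k.-1.+1 by rewrite prednK.
split.
- exact: integrable_uniform_bits.
- apply: (@atomwise_measurable _ (g_sigma_algebraType (residue_classes k)) _ _
    (residue_classes k)).
  + exact: residue_classes_countable.
  + exact: residue_classes_partition.
  + by move=> V DV; exact: sub_sigma_algebra.
  + move=> _ x y [r _ <-]/=; rewrite (minn_idPl kn) => xr yr.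
    by rewrite /rademacher_diff rademacher_mod -kE xr -yr [in LHS]kE -rademacher_mod.
- move=> _ [r _ <-]; rewrite integral_uniform_bits; congr (_%:E).
  rewrite (minn_idPl _) ?(leq_trans (leq_pred k))//.
  rewrite (sum_rademacher_eq0 (g := fun i => \1__ i)) ?mulr0 -?kE//.
  move=> i; rewrite !indicE; congr (_%:R); congr nat_of_bool.
  by apply/idP/idP; rewrite !inE/= modn_mod.
Qed.

Lemma rademacher_square_function_le :
  Lnorm uniform_bits +oo
    (square_function uniform_bits residue_classes n rademacher_diff)
  <= (Num.sqrt n%:R)%:E.
Proof.
have maj1 k x : (1 <= k <= n)%N ->
    predictable_majorant uniform_bits residue_classes rademacher_diff k x <= 1.
  move=> kn; have [V DV Vx] := partition_mem x (residue_classes_partition k.-1).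
  rewrite (predictable_majorantE residue_classes_filtration _ DV Vx).
  rewrite Lnorm_probability_oo; apply/ess_supP; apply: nearW => i /=.
  rewrite lee_fin normrM /rademacher_diff /rademacher normrX normrN1 expr1n mulr1.
  by rewrite indicE; case: (_ \in _); rewrite ?normr1 ?normr0.
rewrite Lnorm_probability_oo; apply/ess_supP; apply: nearW => x /=.
rewrite gee0_abs ?sqrte_ge0// -[leRHS]/(sqrte n%:R%:E) lee_sqrt ?lee_fin//.
apply: (@le_trans _ _ (\sum_(1 <= k < n.+1) 1)).
  rewrite !big_seq; apply: lee_sum => k; rewrite mem_index_iota ltnS => kn.
  rewrite gee0_abs ?predictable_majorant_ge0// -[leRHS]mule1 expe2.
  by rewrite lee_pmul ?maj1 ?predictable_majorant_ge0.
by rewrite sumEFin sumr_const_nat subSS subn0.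
Qed.

End uniform_bits.

(** * Lower bound for the Luxemburg norm and sharpness *)

Lemma luxemburg_norm_ge disp (T : measurableType disp) (R : realType)
    (P : probability T R) (f : T -> R) (u : R) : (0 < u)%R ->
  measurable_fun [set: T] f ->
  (1 < 'E_P[fun x => psi_exp2 (f x / u)])%E ->
  (u%:E <= luxemburg_norm P (@psi_exp2 R) f)%E.
Proof.
move=> u0 mf fu; apply: le_ereal_inf_tmp => _ [v [v0 fv] <-]; rewrite lee_fin leNgt.
(* An admissible v < u would make u admissible, because psi(f / u) <= psi(f / v). *)
apply/negP => vu; move: fu; apply/negP; rewrite -leNgt.
apply: le_trans fv; rewrite expectation.unlock.
have mpsi w : measurable_fun [set: T] (fun x => (psi_exp2 (f x / w))%:E).
  apply/measurable_EFinP; rewrite /psi_exp2; apply: measurable_funB => //.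
  apply: measurableT_comp => //; apply: measurable_funX.
  exact: measurable_funM.
apply: ge0_le_integral => //.
  by move=> x _; rewrite lee_fin /psi_exp2 subr_ge0 -expR0 ler_expR sqr_ge0.
move=> x _; rewrite lee_fin /psi_exp2 lerB// ler_expR !exprMn ler_wpM2l ?sqr_ge0//.
rewrite ler_sqr ?nnegrE ?invr_ge0 ?(ltW u0) ?(ltW v0)// lef_pV2 ?posrE//.
exact: ltW.
Qed.

Local Open Scope ereal_scope.

Lemma square_function_constant_sharp (R : realType) (c : R) :
  (c < Num.sqrt (8 / 3))%R ->
  exists (disp : measure_display) (T : measurableType disp)
    (P : probability T R) (D : nat -> set (set T)) (n : nat)
    (d : nat -> T -> R),
    [/\ (1 <= n)%N, discrete_filtration P D, martingale_difference P D n d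
      & c%:E * Lnorm P +oo (square_function P D n d)
        < luxemburg_norm P (@psi_exp2 R)
            (fun x => \sum_(1 <= k < n.+1) d k x)%R].
Proof.
move=> cK; set K := Num.sqrt (8 / 3) in cK.
have K2 : (K ^+ 2 = 8 / 3)%R by rewrite sqr_sqrtr//; lra.
have K32 : (3 / 2 < K)%R.
  by rewrite -ltr_sqr ?nnegrE ?sqrtr_ge0 ?K2//; lra.
(* Raising [c] to at least 3/2 covers negative values and ensures 2 / c2^2 < 1; the gap between c1
   and c2 gives the strict inequality. *)
pose c1 := (Num.max c (3 / 2))%R; pose c2 := ((c1 + K) / 2)%R.
have c1K : (c1 < K)%R by rewrite gt_max cK.
have c1_ge : (3 / 2 <= c1)%R by rewrite le_max lexx orbT.
have [c12 c2K] : (c1 < c2)%R /\ (c2 < K)%R by rewrite /c2; split; lra.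
have c20 : (0 < c2)%R by lra.
(* Chosen so that (S_n / (c2 sqrt n))^2 = (t / 2) S_n^2 / n; then t > 3/4 amounts to c2^2 < 8/3. *)
pose t := (2 / c2 ^+ 2)%R.
have t01 : (3 / 4 < t < 1)%R.
  have lo : (9 / 4 < c2 ^+ 2)%R by nra.
  have hi : (c2 ^+ 2 < 8 / 3)%R by rewrite -K2 ltr_sqr ?nnegrE ?sqrtr_ge0// ltW.
  have c220 : (0 < c2 ^+ 2)%R by lra.
  by rewrite /t ltr_pdivlMr// ltr_pdivrMr//; apply/andP; split; lra.
have [n [n0 gt2]] := rademacher_expR_gt2 t01.
have nR : (0 < n%:R :> R)%R by rewrite ltr0n.
exists _, nat, (uniform_bits R n : probability _ _), (residue_classes n), n.
exists (@rademacher_diff R); split=> //.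
- exact: residue_classes_filtration.
- exact: rademacher_diff_martingale.
set N := Lnorm _ _ _.
have N0 : 0 <= N by exact: Lnorm_ge0.
have Nn : N <= (Num.sqrt n%:R)%:E by exact: rademacher_square_function_le.
have sn : (0 < Num.sqrt n%:R :> R)%R by rewrite sqrtr_gt0.
apply: (@lt_le_trans _ _ (c2 * Num.sqrt n%:R)%:E).
  apply: (@le_lt_trans _ _ (c1 * Num.sqrt n%:R)%:E).
    apply: (@le_trans _ _ (c1%:E * N)).
      by rewrite lee_wpmul2r// lee_fin le_max lexx.
    by rewrite EFinM lee_wpmul2l// lee_fin; lra.
  by rewrite lte_fin ltr_pM2r.
apply: luxemburg_norm_ge; first by rewrite mulr_gt0.
  exact: measurable_fun_nat.
rewrite expectation.unlock integral_uniform_bits lte_fin.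
have -> : (2 ^- n * (\sum_(i < 2 ^ n) \1_[set: nat] (i : nat) *
      psi_exp2 ((\sum_(1 <= k < n.+1) rademacher_diff R k i) /
        (c2 * Num.sqrt n%:R))) =
    2 ^- n * (\sum_(i < 2 ^ n)
      expR (t / 2 * rademacher_sum R n i ^+ 2 / n%:R)) - 1 :> R)%R.
  have one : (1 = 2 ^- n * \sum_(i < 2 ^ n) 1 :> R)%R.
    by rewrite sumr_const card_ord natrX mulVf// expf_neq0.
  rewrite [X in (_ = _ - X)%R]one -mulrBr -sumrB; congr (_ * _)%R.
  apply: eq_bigr => i _; rewrite indicT mul1r /psi_exp2; congr (expR _ - _)%R.
  rewrite /rademacher_diff big_add1/= big_mkord -/(rademacher_sum R n i).
  rewrite !exprMn exprVn exprMn sqr_sqrtr ?ltW// /t; field.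
  by rewrite !gt_eqF.
by lra.
Qed.

Theorem corollary1p4 (R : realType) :
  (forall (disp : measure_display) (T : measurableType disp)
      (P : probability T R) (D : nat -> set (set T)) (n : nat)
      (d : nat -> T -> R),
    (1 <= n)%N -> discrete_filtration P D -> martingale_difference P D n d ->
    luxemburg_norm P (@psi_exp2 R) (fun x => \sum_(1 <= k < n.+1) d k x)%R
      <= (Num.sqrt (8%:R / 3%:R))%:E * Lnorm P +oo (square_function P D n d))
  /\
  (forall c : R, (c < Num.sqrt (8%:R / 3%:R))%R ->
    exists (disp : measure_display) (T : measurableType disp)
      (P : probability T R) (D : nat -> set (set T)) (n : nat)
      (d : nat -> T -> R),
      [/\ (1 <= n)%N, discrete_filtration P D, martingale_difference P D n d
        & c%:E * Lnorm P +oo (square_function P D n d)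
          < luxemburg_norm P (@psi_exp2 R)
              (fun x => \sum_(1 <= k < n.+1) d k x)%R]).
Proof.
split=> [disp T P D n d _ filtD md|c]; last exact: square_function_constant_sharp.
exact: luxemburg_norm_le_square_function.
Qed.
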